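(* Let $R$ be a ring and $I$ an ideal of $R$. Consider the following conditions: (1) Every finitely generated left $R$-module has a projective $I$-cover. (2) Every factor module of ${}_RR$ has a projective $I$-cover. (3) For every countably generated left ideal $K$ of $R$, $R/K$ has a projective $I$-cover. (4) $R$ is $I$-semiperfect. (5) Every simple left $R$-module has a projective $I$-cover. (6) Every simple factor module of ${}_RR$ has a projective $I$-cover. Then $(1)\Rightarrow(2)\Rightarrow(3)\Rightarrow(4)$ and $(1)\Rightarrow(5)\Rightarrow(6)$; $(4)\Rightarrow(1)$ holds if $R$ is a left PSD ring for $I$; and $(6)\Rightarrow(4)$ holds if $I$ is PSD in ${}_RR$.
   Context: Rings are associative with identity; modules are unital left modules; ideals are two-sided. A ''summand'' is a direct summand; a ''projective summand'' is a direct summand that is a projective module. PSD: a submodule $N\leq M$ is PSD in $M$ if for every submodule $X\leq M$ with $N+X=M$ there is a projective summand $S$ of $M$ with $S\leq N$ and $M=S\oplus X$. A module $M$ is PSD for $I$ if every submodule of $IM$ is PSD in $M$. $R$ is a left PSD ring for $I$ if every finitely generated free left $R$-module is PSD for $I$. Projective $I$-cover: a pair $(P,f)$ is a projective $I$-cover of a module $M$ if $P$ is projective, $f:P\to M$ is an epimorphism with $\mathrm{Ker} f\leq IP$, and $\mathrm{Ker} f$ is PSD in $P$. $I$-semiperfect: a module $M$ is $I$-semiperfect if for every submodule $K$ of $M$ there is a decomposition $M=A\oplus B$ with $A$ projective, $A\subseteq K$ and $K\cap B\subseteq IM$. The ring $R$ is $I$-semiperfect if ${}_RR$ is an $I$-semiperfect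 module. *)

(* Defs.v *)
From HB Require Import structures.
From mathcomp Require Import all_boot all_order all_algebra.
From mathcomp Require Import generic_quotient ring_quotient.
From mathcomp Require Import boolp classical_sets cardinality.

Set Implicit Arguments.
Unset Strict Implicit.
Unset Printing Implicit Defensive.

Import GRing.Theory.
Local Open Scope classical_set_scope.
Local Open Scope ring_scope.

(* Rings are arbitrary [pzRingType]s: not necessarily commutative, and the zero
   ring is allowed.  [lmodType R] is the type of unital left R-modules, and
   [R^o] is R seen as a left module over itself. *)

Record submodule (R : pzRingType) (M : lmodType R) := Submodule {
  submodule_set :> set M;
  submodule0 : submodule_set 0;
  submoduleD : forall x y,
    submodule_set x -> submodule_set y -> submodule_set (x + y);
  submoduleZ : forall (a : R) x, submodule_set x -> submodule_set (a *: x)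
}.

(* A submodule of [R^o] is a left ideal, since [a *: x] is [a * x] there. *)
Record ideal (R : pzRingType) := Ideal {
  ideal_submodule :> submodule R^o;
  idealMr : forall x r : R,
    submodule_set ideal_submodule x -> submodule_set ideal_submodule (x * r)
}.

(* Submodules as modules, and quotient modules.  The library constructions
   expect a boolean closed predicate, which [asbool] provides. *)
Definition submodule_pred (R : pzRingType) (M : lmodType R)
    (K : submodule M) : pred M := fun x => `[< submodule_set K x >].

Lemma submodule_pred_closed (R : pzRingType) (M : lmodType R)
  (K : submodule M) : submod_closed (submodule_pred K).
Proof.
split=> [|a u v /asboolP Ku /asboolP Kv]; apply/asboolP.
  exact: submodule0.
by apply: submoduleD => //; apply: submoduleZ.
Qed.

HB.instance Definition _ (R : pzRingType) (M : lmodType R) (K : submodule M) :=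
  GRing.isSubmodClosed.Build R M (submodule_pred K) (submodule_pred_closed K).

Definition sub_mod (R : pzRingType) (M : lmodType R) (K : submodule M) : Type :=
  {x : M | submodule_pred K x}.

HB.instance Definition _ (R : pzRingType) (M : lmodType R) (K : submodule M) :=
  SubChoice.on (sub_mod K).
HB.instance Definition _ (R : pzRingType) (M : lmodType R) (K : submodule M) :=
  [SubChoice_isSubLmodule of sub_mod K by <:].

Definition submodule_zmod (R : pzRingType) (M : lmodType R)
    (K : submodule M) : zmodClosed M :=
  GRing.ZmodClosed.clone M (submodule_pred K) _.

Definition quot_mod (R : pzRingType) (M : lmodType R) (K : submodule M) : Type :=
  Quotient.quot (submodule_zmod K).

HB.instance Definition _ (R : pzRingType) (M : lmodType R) (K : submodule M) :=
  GRing.Zmodule.on (quot_mod K).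

Section QuotientModule.
Variables (R : pzRingType) (M : lmodType R) (K : submodule M).

Definition quot_proj (x : M) : quot_mod K :=
  \pi_(Quotient.quot (submodule_zmod K))%qT x.

Lemma quot_projD : {morph quot_proj : x y / x + y}.
Proof.
exact: (@raddfD _ _ (\pi_(Quotient.quot (submodule_zmod K)))%qT).
Qed.

Lemma quot_proj_eq (x y : M) : quot_proj x = quot_proj y <-> submodule_set K (x - y).
Proof.
have H := Quotient.idealrBE (submodule_zmod K) x y.
split=> [/eqP|Kxy]; first by rewrite -H => /asboolP.
by apply/eqP; rewrite -H; apply/asboolP.
Qed.

Definition quot_repr (q : quot_mod K) : M :=
  @repr _ (Quotient.quot (submodule_zmod K)) q.

Lemma quot_reprK : cancel quot_repr quot_proj.
Proof. by move=> q; rewrite /quot_proj /quot_repr reprK. Qed.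

Definition quot_scale (a : R) (q : quot_mod K) : quot_mod K :=
  quot_proj (a *: quot_repr q).

Lemma quot_scale_proj a x : quot_scale a (quot_proj x) = quot_proj (a *: x).
Proof.
apply/quot_proj_eq; rewrite -scalerBr; apply: submoduleZ.
by apply/quot_proj_eq; rewrite quot_reprK.
Qed.

Lemma quot_scaleA a b q : quot_scale a (quot_scale b q) = quot_scale (a * b) q.
Proof. by rewrite -[q]quot_reprK !quot_scale_proj scalerA. Qed.

Lemma quot_scale1 : left_id 1 quot_scale.
Proof. by move=> q; rewrite -[q]quot_reprK quot_scale_proj scale1r. Qed.

Lemma quot_scaleDr : right_distributive quot_scale +%R.
Proof.
move=> a p q; rewrite -[p]quot_reprK -[q]quot_reprK -quot_projD.
by rewrite !quot_scale_proj scalerDr quot_projD.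
Qed.

Lemma quot_scaleDl q : {morph quot_scale^~ q : a b / a + b}.
Proof.
by move=> a b; rewrite -[q]quot_reprK !quot_scale_proj scalerDl quot_projD.
Qed.

HB.instance Definition _ := GRing.Zmodule_isLmodule.Build R (quot_mod K)
  quot_scaleA quot_scale1 quot_scaleDr quot_scaleDl.

Lemma quot_proj_linear : linear quot_proj.
Proof.
move=> a x y; rewrite quot_projD; congr (_ + _).
by rewrite -quot_scale_proj.
Qed.

HB.instance Definition _ :=
  GRing.isLinear.Build R M (quot_mod K) _ quot_proj quot_proj_linear.

End QuotientModule.

Section Kernel.
Variables (R : pzRingType) (M N : lmodType R) (f : {linear M -> N}).

Definition ker_set : set M := [set x | f x = 0].

Lemma ker_set0 : ker_set 0. Proof. exact: raddf0. Qed.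

Lemma ker_setD x y : ker_set x -> ker_set y -> ker_set (x + y).
Proof. by rewrite /ker_set /= linearD => -> ->; rewrite addr0. Qed.

Lemma ker_setZ (a : R) x : ker_set x -> ker_set (a *: x).
Proof. by rewrite /ker_set /= linearZZ => ->; rewrite scaler0. Qed.

Definition kernel : submodule M := Submodule ker_set0 ker_setD ker_setZ.

End Kernel.

Definition surjective (T U : Type) (f : T -> U) : Prop :=
  forall y, exists x, f x = y.

(* Finite sums of elements [a *: m] with [a] in [A] and [m] in [X]. *)
Definition lin_combs (R : pzRingType) (M : lmodType R) (A : set R) (X : set M) :
    set M :=
  [set x | exists (n : nat) (a : 'I_n -> R) (m : 'I_n -> M),
     (forall i, A (a i) /\ X (m i)) /\ x = \sum_(i < n) a i *: m i].

Definition span (R : pzRingType) (M : lmodType R) (X : set M) : set M :=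
  lin_combs setT X.

Definition ideal_mul (R : pzRingType) (I : ideal R) (M : lmodType R) : set M :=
  @lin_combs R M I setT.
Arguments ideal_mul {R} I M.

Definition finitely_generated (R : pzRingType) (M : lmodType R) : Prop :=
  exists X : set M, finite_set X /\ span X = setT.

(* [countable] includes finite sets. *)
Definition countably_generated (R : pzRingType) (M : lmodType R)
    (K : submodule M) : Prop :=
  exists X : set M, countable X /\ span X = K.

Definition fg_free (R : pzRingType) (M : lmodType R) : Prop :=
  exists (n : nat) (f : {linear 'rV[R]_n -> M}), bijective f.

Definition simple_module (R : pzRingType) (M : lmodType R) : Prop :=
  (exists x : M, x <> 0) /\
  forall K : submodule M, (K : set M) = [set 0] \/ (K : set M) = setT.

Definition projective (R : pzRingType) (P : lmodType R) : Prop :=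
  forall (A B : lmodType R) (g : {linear A -> B}) (h : {linear P -> B}),
    surjective g -> exists k : {linear P -> A}, forall x, g (k x) = h x.

Definition submodule_sum (R : pzRingType) (M : lmodType R)
    (A B : submodule M) : set M :=
  [set x | exists a b, [/\ submodule_set A a, submodule_set B b & x = a + b]].

Definition direct_decomposition (R : pzRingType) (M : lmodType R)
    (A B : submodule M) : Prop :=
  submodule_sum A B = setT /\ A `&` B = [set 0].

Definition psd_in (R : pzRingType) (M : lmodType R) (N : submodule M) : Prop :=
  forall X : submodule M, submodule_sum N X = setT ->
  exists S : submodule M,
    [/\ projective (sub_mod S), S `<=` N & direct_decomposition S X].

Definition psd_for (R : pzRingType) (I : ideal R) (M : lmodType R) : Prop :=
  forall N : submodule M, N `<=` ideal_mul I M -> psd_in N.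

Definition left_psd_ring (R : pzRingType) (I : ideal R) : Prop :=
  forall M : lmodType R, fg_free M -> psd_for I M.

Definition projective_cover (R : pzRingType) (I : ideal R) (M P : lmodType R)
    (f : {linear P -> M}) : Prop :=
  [/\ projective P, surjective f, kernel f `<=` ideal_mul I P
    & psd_in (kernel f)].

Definition has_projective_cover (R : pzRingType) (I : ideal R)
    (M : lmodType R) : Prop :=
  exists (P : lmodType R) (f : {linear P -> M}), projective_cover I f.

Definition semiperfect_module (R : pzRingType) (I : ideal R)
    (M : lmodType R) : Prop :=
  forall K : submodule M, exists A B : submodule M,
    [/\ direct_decomposition A B, projective (sub_mod A), A `<=` K
      & K `&` B `<=` ideal_mul I M].

Definition semiperfect_ring (R : pzRingType) (I : ideal R) : Prop :=
  semiperfect_module I R^o.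

(* Main.v *)
(* For a left ideal [K], a decomposition of [R] as in the definition of
   [I]-semiperfectness amounts to an idempotent [e] of [K] with [x - xe] in [I]
   for all [x] in [K], and a projective [I]-cover of [R/K] yields such an [e].

   (3) => (4) and (6) => (4): if [K] had no such idempotent, [K] would contain
   an infinite chain of idempotents with successive differences outside [I].
   Under (3), the splitting of the countably generated union of the chain is
   contradictory.  Under (6), every maximal left ideal splits, so by Zorn's
   lemma every left ideal containing [I] has a complement modulo [I], and the
   same contradiction follows; that [I] is PSD is what lifts idempotents, hence
   allows the chain to be built.

   (4) => (1): splitting one coordinate at a time, every kernel [K] in [R^n] has
   a decomposition [A + B] of [R^n] with [A] inside [K] and [K `&` B] inside
   [I R^n]; the restriction to [B] of [R^n -> M] is the cover. *)

Require Import Defs.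
From HB Require Import structures.
From mathcomp Require Import all_boot all_order all_algebra.
From mathcomp Require Import boolp classical_sets cardinality.

Set Implicit Arguments.
Unset Strict Implicit.
Unset Printing Implicit Defensive.

Import GRing.Theory.
Local Open Scope classical_set_scope.
Local Open Scope ring_scope.

Local Identity Coercion fun_of_set : set >-> Funclass.

(** * Sums, intersections and cyclic submodules; maximal submodules avoiding a set *)

Section Submodules.
Variables (R : pzRingType) (M : lmodType R).
Implicit Types A B K : submodule M.

Lemma submoduleN K x : K x -> K (- x).
Proof. by move=> Kx; rewrite -scaleN1r; apply: submoduleZ. Qed.

Lemma submoduleB K x y : K x -> K y -> K (x - y).
Proof. by move=> Kx Ky; apply: submoduleD => //; apply: submoduleN. Qed.

Lemma submodule_bigsum K n (F : 'I_n -> M) :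
  (forall i, K (F i)) -> K (\sum_(i < n) F i).
Proof.
move=> KF; elim/big_ind: _ => [|x y Kx Ky|//]; first exact: submodule0.
exact: submoduleD.
Qed.

Lemma lin_combs_sub (D : set R) (T : set M) K :
  (forall a m, D a -> T m -> K (a *: m)) -> lin_combs D T `<=` K.
Proof.
move=> KDT x [n [a [m [am ->]]]]; apply: submodule_bigsum => i.
by have [Da Tm] := am i; apply: KDT.
Qed.

Lemma lin_combs1 (D : set R) (T : set M) a m :
  D a -> T m -> lin_combs D T (a *: m).
Proof.
move=> Da Tm; exists 1, (fun=> a), (fun=> m); split=> //.
by rewrite big_ord1.
Qed.

Lemma submodule_sum0 A B : submodule_sum A B 0.
Proof. by exists 0, 0; split; rewrite ?addr0 //; exact: submodule0. Qed.

Lemma submodule_sumD A B x y :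
  submodule_sum A B x -> submodule_sum A B y -> submodule_sum A B (x + y).
Proof.
move=> [a [b [Aa Bb ->]]] [c [d [Ac Bd ->]]]; exists (a + c), (b + d).
by split; [apply: submoduleD..|rewrite addrACA].
Qed.

Lemma submodule_sumZ A B r x :
  submodule_sum A B x -> submodule_sum A B (r *: x).
Proof.
move=> [a [b [Aa Bb ->]]]; exists (r *: a), (r *: b).
by split; [apply: submoduleZ..|rewrite scalerDr].
Qed.

Definition join A B : submodule M :=
  Submodule (submodule_sum0 A B) (@submodule_sumD A B) (@submodule_sumZ A B).

Lemma join_subl A B : A `<=` join A B.
Proof.
by move=> a Aa; exists a, 0; split; rewrite ?addr0 //; exact: submodule0.
Qed.

Lemma join_subr A B : B `<=` join A B.
Proof.
by move=> b Bb; exists 0, b; split; rewrite ?add0r //; exact: submodule0.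
Qed.

Lemma meet0 A B : (A `&` B) 0.
Proof. by split; exact: submodule0. Qed.

Lemma meetD A B x y : (A `&` B) x -> (A `&` B) y -> (A `&` B) (x + y).
Proof. by move=> [? ?] [? ?]; split; apply: submoduleD. Qed.

Lemma meetZ A B a x : (A `&` B) x -> (A `&` B) (a *: x).
Proof. by move=> [? ?]; split; apply: submoduleZ. Qed.

Definition meet A B : submodule M :=
  Submodule (meet0 A B) (@meetD A B) (@meetZ A B).

Definition full_submodule : submodule M :=
  @Submodule R M setT Logic.I (fun _ _ _ _ => Logic.I) (fun _ _ _ => Logic.I).

Definition cyclic_set (x : M) : set M := [set y | exists a : R, y = a *: x].

Lemma cyclic_set0 x : cyclic_set x 0.
Proof. by exists 0; rewrite scale0r. Qed.

Lemma cyclic_setD x y z :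
  cyclic_set x y -> cyclic_set x z -> cyclic_set x (y + z).
Proof. by move=> [a ->] [b ->]; exists (a + b); rewrite scalerDl. Qed.

Lemma cyclic_setZ x a y : cyclic_set x y -> cyclic_set x (a *: y).
Proof. by move=> [b ->]; exists (a * b); rewrite scalerA. Qed.

Definition cyclic x : submodule M :=
  Submodule (cyclic_set0 x) (@cyclic_setD x) (@cyclic_setZ x).

Lemma cyclic_id x : cyclic x x.
Proof. by exists 1; rewrite scale1r. Qed.

Lemma cyclic_sub K x : K x -> cyclic x `<=` K.
Proof. by move=> Kx _ [a ->]; apply: submoduleZ. Qed.

Lemma cyclic_finitely_generated x :
  (cyclic x : set M) = setT -> finitely_generated M.
Proof.
move=> xT; exists [set x]; split; first exact: finite_set1.
apply/seteqP; split=> // y _; have [a ->] : cyclic x y by rewrite xT.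
exact: lin_combs1.
Qed.

Lemma simple_finitely_generated : simple_module M -> finitely_generated M.
Proof.
move=> [[x x0] /(_ (cyclic x)) [x_0|]]; last exact: cyclic_finitely_generated.
by case: x0; have := cyclic_id x; rewrite x_0.
Qed.

(* The union of the empty chain is empty, whence the extra case [A = set0]. *)
Lemma maximal_disjoint_submodule (Q : submodule M) (D : set M) : Q `&` D `<=` set0 ->
  exists X : submodule M, [/\ Q `<=` X, X `&` D `<=` set0
    & forall Y : submodule M, X `<=` Y -> Y `&` D `<=` set0 -> Y `<=` X].
Proof.
move=> QD.
pose P (A : set M) := A = set0 \/
  exists X : submodule M, [/\ A = X, Q `<=` X & X `&` D `<=` set0].
have [F FP totF|A [PA maxA]] := @Zorn_bigcup M P.
  have [F0|] := pselect (forall C, F C -> C = set0).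
    left; apply/seteqP; split=> // x [A FA Ax].
    by move: Ax; rewrite (F0 _ FA).
  move=> /existsNP[A0 /not_implyP[FA0 A0n]]; right.
  have [|[X0 [A0X QX0 X0D]]] := FP _ FA0; first by [].
  have U0 : (\bigcup_(C in F) C) 0 by exists A0; rewrite // A0X; exact: submodule0.
  have mem (C : set M) x : F C -> C x -> exists X : submodule M, C = X.
    move=> FC Cx; have [C0|[X [CX _ _]]] := FP _ FC; last by exists X.
    by move: Cx; rewrite C0.
  have UD x y : (\bigcup_(C in F) C) x -> (\bigcup_(C in F) C) y ->
      (\bigcup_(C in F) C) (x + y).
    move=> [A FA Ax] [B FB By]; have [AB|BA] := totF _ _ FA FB.
      exists B => //; have [X BX] := mem _ _ FB By; move: (AB _ Ax) By.
      by rewrite BX; exact: submoduleD.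
    exists A => //; have [X AX] := mem _ _ FA Ax; move: Ax (BA _ By).
    by rewrite AX; exact: submoduleD.
  have UZ a x : (\bigcup_(C in F) C) x -> (\bigcup_(C in F) C) (a *: x).
    move=> [A FA Ax]; exists A => //; have [X AX] := mem _ _ FA Ax.
    by move: Ax; rewrite AX; exact: submoduleZ.
  exists (Submodule U0 UD UZ); split=> //.
    by move=> x Qx; exists A0 => //; rewrite A0X; exact: QX0.
  move=> x [[A FA Ax] Dx]; have [A_0|[X [AX _ XD]]] := FP _ FA.
    by move: Ax; rewrite A_0.
  by apply: XD; split; rewrite -?AX.
have PQ (X : submodule M) : Q `<=` X -> X `&` D `<=` set0 -> P X.
  by move=> QX XD; right; exists X.
(* A maximal [A] cannot be empty, because [Q] itself is admissible and strictly larger. *)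
case: PA => [A0|[X [AX QX XD]]].
  case: (maxA Q); last exact: PQ.
  rewrite A0; split=> // Qs.
  by have := Qs 0 (submodule0 Q).
exists X; split=> // Y XY YD y Yy; apply: contrapT => nXy.
case: (maxA Y); last by apply: PQ => // x /QX /XY.
by rewrite AX; split=> // YX; apply/nXy/YX.
Qed.

End Submodules.

(** * Linear maps: projections, images and preimages *)

Lemma linear_of_fun (R : pzRingType) (M N : lmodType R) (f : M -> N) :
  linear f -> exists g : {linear M -> N}, forall x, g x = f x.
Proof.
move=> lf; pose m := GRing.isLinear.Build R M N *:%R f lf.
pose g : {linear M -> N} := HB.pack f m.
by exists g.
Qed.

Section LinearMaps.
Variables (R : pzRingType) (M N : lmodType R).

Lemma corestrict (K : submodule N) (f : {linear M -> N}) :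
  (forall x, K (f x)) ->
  exists g : {linear M -> sub_mod K}, forall x, val (g x) = f x.
Proof.
move=> Kf; have kf x : submodule_pred K (f x) by apply/asboolP.
have lg : linear (fun x => Sub (f x) (kf x) : sub_mod K).
  by move=> a x y; apply: val_inj; rewrite /= linearP.
have [g gE] := linear_of_fun lg.
by exists g => x; rewrite gE.
Qed.

Lemma projection (A B : submodule M) : direct_decomposition A B ->
  exists p : {linear M -> M},
    [/\ forall x, A (p x), forall x, B (x - p x) & forall x, A x -> p x = x].
Proof.
move=> [ABT AB0].
have ex x : exists a, A a /\ B (x - a).
  have : submodule_sum A B x by rewrite ABT.
  by move=> [a [b [Aa Bb ->]]]; exists a; rewrite addrC addKr.
have [f fP] := choice ex.
have lf : linear f.
  move=> r x y; apply/eqP; rewrite -subr_eq0; apply/eqP.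
  suff : (A `&` B) (f (r *: x + y) - (r *: f x + f y)) by rewrite AB0.
  have [[[Ax Bx] [Ay By]] [Az Bz]] := (fP x, fP y, fP (r *: x + y)).
  split; first by apply: submoduleB => //; apply: submoduleD => //; apply: submoduleZ.
  (* The defect of linearity, clearly in [A], is rewritten through the [B]-components and so lies in
     [B] as well. *)
  have -> : f (r *: x + y) - (r *: f x + f y) =
      (r *: (x - f x) + (y - f y)) - (r *: x + y - f (r *: x + y)).
    by rewrite scalerBr addrACA -opprD opprB [RHS]addrC addrA subrK.
  by apply: submoduleB => //; apply: submoduleD => //; apply: submoduleZ.
have [p pE] := linear_of_fun lf.
exists p; split=> x; rewrite pE; [by have [] := fP x|by have [] := fP x|move=> Ax].
have [Afx Bfx] := fP x; apply/eqP; rewrite eq_sym -subr_eq0; apply/eqP.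
suff : (A `&` B) (x - f x) by rewrite AB0.
by split=> //; apply: submoduleB.
Qed.

Lemma image0 (f : {linear M -> N}) (X : submodule M) : (f @` X) 0.
Proof. by exists 0; rewrite ?linear0 //; exact: submodule0. Qed.

Lemma imageD (f : {linear M -> N}) (X : submodule M) x y :
  (f @` X) x -> (f @` X) y -> (f @` X) (x + y).
Proof.
move=> [u Xu <-] [v Xv <-]; exists (u + v); rewrite ?linearD //.
exact: submoduleD.
Qed.

Lemma imageZ (f : {linear M -> N}) (X : submodule M) a x :
  (f @` X) x -> (f @` X) (a *: x).
Proof.
by move=> [u Xu <-]; exists (a *: u); rewrite ?linearZ //; exact: submoduleZ.
Qed.

Definition image_submodule (f : {linear M -> N}) X : submodule N :=
  Submodule (image0 f X) (@imageD f X) (@imageZ f X).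

Lemma preimage0 (f : {linear M -> N}) (K : submodule N) : (f @^-1` K) 0.
Proof. by rewrite /preimage /= linear0; exact: submodule0. Qed.

Lemma preimageD (f : {linear M -> N}) (K : submodule N) x y :
  (f @^-1` K) x -> (f @^-1` K) y -> (f @^-1` K) (x + y).
Proof. by rewrite /preimage /= linearD; exact: submoduleD. Qed.

Lemma preimageZ (f : {linear M -> N}) (K : submodule N) a x :
  (f @^-1` K) x -> (f @^-1` K) (a *: x).
Proof. by rewrite /preimage /= linearZ; exact: submoduleZ. Qed.

Definition preimage_submodule (f : {linear M -> N}) K : submodule M :=
  Submodule (preimage0 f K) (@preimageD f K) (@preimageZ f K).

Lemma ideal_mul_map (I : ideal R) (f : {linear M -> N}) x :
  ideal_mul I M x -> ideal_mul I N (f x).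
Proof.
move=> [n [a [m [am ->]]]]; exists n, a, (f \o m); split.
  by move=> i; have [] := am i.
by rewrite linear_sum; apply: eq_bigr => i _; rewrite linearZ.
Qed.

End LinearMaps.

(** * Projective modules and direct decompositions *)

Lemma free_projective (R : pzRingType) n : projective 'rV[R]_n.
Proof.
move=> A B g h gs.
have [a aE] := choice (fun i : 'I_n => gs (h (delta_mx 0 i))).
have lk : linear (fun v : 'rV[R]_n => \sum_i v 0 i *: a i).
  move=> r u v; rewrite scaler_sumr -big_split /=; apply: eq_bigr => i _.
  by rewrite !mxE scalerDl scalerA.
have [k kE] := linear_of_fun lk; exists k => v; rewrite kE linear_sum.
rewrite [v in RHS]row_sum_delta linear_sum; apply: eq_bigr => i _.
by rewrite !linearZ /= aE.
Qed.

Lemma regular_projective (R : pzRingType) : projective R^o.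
Proof.
move=> A B g h /(_ (h 1))[a aE].
have lk : linear (fun x : R^o => (x : R) *: a).
  by move=> r x y; rewrite scalerDl scalerA.
have [k kE] := linear_of_fun lk; exists k => x.
by rewrite kE linearZ /= aE -linearZ /= /GRing.scale /= mulr1.
Qed.

Lemma direct_decompositionC (R : pzRingType) (M : lmodType R)
  (A B : submodule M) : direct_decomposition A B -> direct_decomposition B A.
Proof.
move=> [ABT AB0]; split; last by rewrite setIC.
apply/seteqP; split=> // x _; have : submodule_sum A B x by rewrite ABT.
by move=> [a [b [Aa Bb ->]]]; exists b, a; rewrite addrC.
Qed.

Lemma direct_decompositionP (R : pzRingType) (M : lmodType R)
    (A B : submodule M) :
  (forall x, submodule_sum A B x) -> (forall x, A x -> B x -> x = 0) ->
  direct_decomposition A B.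
Proof.
move=> AB AB0; split; first by apply/seteqP; split.
apply/seteqP; split=> x; first by move=> []; exact: AB0.
by move=> ->; split; exact: submodule0.
Qed.

Lemma summand_projective (R : pzRingType) (P : lmodType R)
    (A B : submodule P) :
  projective P -> direct_decomposition A B -> projective (sub_mod A).
Proof.
move=> PP /projection[p [Ap _ pid]] C D g h gs.
have [q qE] := corestrict Ap.
have [k kE] := PP _ _ g [the {linear _ -> _} of h \o q] gs.
exists [the {linear _ -> _} of k \o val] => x /=.
rewrite kE /=; congr (h _); apply: val_inj; rewrite qE pid //.
by have /asboolP := valP x.
Qed.

(** * Left ideals split modulo [I] by an idempotent *)

Section RegularModule.
Variables (R : pzRingType) (I : ideal R).
Implicit Types K L N Q : submodule R^o.

Lemma left_idealMl K (x a : R) : K x -> K (a * x).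
Proof. exact: submoduleZ. Qed.

Lemma ideal_mul_regular : ideal_mul I R^o = I.
Proof.
apply/seteqP; split; first by apply: lin_combs_sub => a m Ia _; exact: Defs.idealMr.
move=> x Ix; rewrite -[x]mulr1; exact: (@lin_combs1 _ R^o I setT x 1).
Qed.

(* [I_splits K] says that [K = Re + (K `&` R (1 - e))] with the second
   summand inside [I]. *)
Definition I_splits K := exists e : R,
  [/\ K e, e * e = e & forall x : R, K x -> I (x - x * e)].

Lemma annihilator0 (e : R) : [set x : R^o | (x : R) * e = 0] 0.
Proof. exact: mul0r. Qed.

Lemma annihilatorD (e : R) (x y : R^o) :
  [set x : R^o | (x : R) * e = 0] x -> [set x : R^o | (x : R) * e = 0] y ->
  [set x : R^o | (x : R) * e = 0] (x + y).
Proof. by rewrite /= mulrDl => -> ->; rewrite addr0. Qed.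

Lemma annihilatorZ (e a : R) (x : R^o) :
  [set x : R^o | (x : R) * e = 0] x ->
  [set x : R^o | (x : R) * e = 0] (a *: x).
Proof. by rewrite /= -mulrA => ->; rewrite mulr0. Qed.

Definition annihilator e : submodule R^o :=
  Submodule (annihilator0 e) (@annihilatorD e) (@annihilatorZ e).

(** The component of 1 in [A] is the idempotent [e]: for [x] in [K], [x - x e] is [x] times the
    component of 1 in [B], hence lies in both [K] and [B]. Conversely, R is the direct sum of Re and
    the left annihilator of [e]. *)
Lemma semiperfect_I_splits :
  semiperfect_ring I <-> forall K, I_splits K.
Proof.
split=> [sp K|spl K].
  have [A [B [[ABT AB0] _ AK KB]]] := sp K.
  have : submodule_sum A B 1 by rewrite ABT.
  move=> [e [b [Ae Bb e1]]]; exists e.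
  have xb (x : R) : x - x * e = x * b.
    by rewrite -{1}[x]mulr1 e1 mulrDr addrC addKr.
  have xbB (x : R) : B (x * b) by exact: submoduleZ.
  split; first exact: AK.
    apply/eqP; rewrite eq_sym -subr_eq0; apply/eqP.
    suff : (A `&` B) (e - e * e) by rewrite AB0.
    split; last by rewrite xb.
    by apply: submoduleB => //; exact: left_idealMl.
  move=> x Kx; rewrite -ideal_mul_regular; apply: KB; split; last by rewrite xb.
  by apply: submoduleB => //; apply: AK; exact: left_idealMl.
have [e [Ke ee Ie]] := spl K.
have dec : direct_decomposition (cyclic (e : R^o)) (annihilator e).
  apply: direct_decompositionP => [x|x [a ->]] /=.
    exists ((x : R) * e), (x - x * e : R); split.
    - by exists x.
    - by rewrite /= mulrBl -mulrA ee subrr.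
    - by rewrite addrC subrK.
  by rewrite /GRing.scale /= -mulrA ee.
exists (cyclic (e : R^o)), (annihilator e); split=> //.
- by apply: summand_projective dec; exact: regular_projective.
- exact: cyclic_sub.
- by move=> x [Kx /= xe]; rewrite ideal_mul_regular -[x]subr0 -xe; exact: Ie.
Qed.

(** A lift [g] of R -> R/K along [f] has image Rq with Ker f + Rq = Q, so PSD makes Rq a summand.
    The projection of [Q] onto Rq lifts along R -> Rq to a map [k] from [Q] to R; then [u = k q] is
    idempotent with [u q = q], and [1 - u] is the idempotent sought in [K]. *)
Lemma cover_I_splits K : has_projective_cover I (quot_mod K) -> I_splits K.
Proof.
move=> [Q [f [QP fs fI fpsd]]].
have [g gE] := regular_projective (quot_proj K : {linear R^o -> quot_mod K}) fs.
have gZ (r : R) : g r = r *: g 1.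
  by rewrite -linearZ /= /GRing.scale /= mulr1.
set q := g 1 in gZ.
have [|S [_ Sf SX]] := fpsd (cyclic q).
  apply/seteqP; split=> // z _; exists (z - g (quot_repr (f z))).
  exists (g (quot_repr (f z))); split.
  - by rewrite /kernel /ker_set /= linearB /= gE /= quot_reprK subrr.
  - by exists (quot_repr (f z)); exact: gZ.
  - by rewrite subrK.
have [p [pX _ pid]] := projection (direct_decompositionC SX).
have [p' p'E] := corestrict pX.
have gX x : cyclic q (g x) by exists x; exact: gZ.
have [g' g'E] := corestrict gX.
have g's : surjective g'.
  move=> y; have /asboolP[a ya] := valP y.
  by exists a; apply: val_inj; rewrite g'E gZ ya.
have [k kE] := QP _ _ g' p' g's.
have kq z : (k z : R) *: q = p z by rewrite -gZ -g'E kE p'E.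
pose u : R := k q.
have uq : u *: q = q by rewrite kq pid //; exact: cyclic_id.
have ku (r : R) : k (r *: q) = r * u by rewrite linearZ.
exists (1 - u); split.
- rewrite -[1 - u]subr0; apply/quot_proj_eq.
  by rewrite linear0 -gE gZ scalerBl scale1r uq subrr linear0.
- have uu : u * u = u by rewrite -ku uq.
  by rewrite mulrBr mulr1 mulrBl mul1r uu subrr subr0.
(* Here [x - x (1 - u) = x u = k (x q)], and [x q] lies in Ker f, hence in IQ, which [k] maps into
   [I]. *)
- move=> x Kx; rewrite mulrBr mulr1 opprB addrC subrK -ku -ideal_mul_regular.
  apply: ideal_mul_map; apply: fI; rewrite /kernel /ker_set /= -gZ gE.
  by rewrite -[RHS](linear0 (quot_proj K)); apply/quot_proj_eq; rewrite subr0.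
Qed.

(* If no [e] works for [K], one builds an increasing sequence of idempotents of
   [K] whose successive differences are idempotents outside [I]; this is
   incompatible with the second hypothesis for the union of the left ideals
   they generate. *)
Lemma I_splits_of_chain :
  (forall L, ~ (L `<=` I) -> exists f : R, [/\ L f, f * f = f & ~ I f]) ->
  (forall K, countably_generated K ->
    exists n : R, K n /\ forall x : R, K x -> I (x - x * n)) ->
  forall K, I_splits K.
Proof.
move=> idem cgen K; apply: contrapT => nK.
have step (e : R) : exists e' : R, K e /\ e * e = e ->
    [/\ K e', e' * e' = e', e * e' = e, e' * e = e & ~ I (e' - e)].
  (* The value 0 at an [e] that is not an idempotent of [K] only makes the step total, so that it
     can be iterated. *)
  have [[Ke ee]|nKe] := pselect (K e /\ e * e = e); last first.
    by exists 0 => /nKe.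
  have /existsNP[x /not_implyP[Kx nIx]] : ~ forall x : R, K x -> I (x - x * e).
    by move=> H; apply: nK; exists e.
  have [|f [[Kf /= fe] ff nIf]] := idem (meet K (annihilator e)).
    move=> /(_ (x - x * e)) KI; apply: nIx; apply: KI; split.
      by apply: submoduleB => //; exact: left_idealMl.
    by rewrite /= mulrBl -mulrA ee subrr.
  (* [d = (1 - e) f] is orthogonal to [e] on both sides, so [e + d] is idempotent; [f d = f] keeps
     [d] outside [I]. *)
  have [d dE] : exists d, d = f - e * f by exists (f - e * f).
  have Ed : e * d = 0 by rewrite dE mulrBr mulrA ee subrr.
  have de : d * e = 0 by rewrite dE mulrBl -mulrA fe mulr0 subrr.
  have fd : f * d = f by rewrite dE mulrBr ff mulrA fe mul0r subr0.
  have dd : d * d = d by rewrite {1}dE mulrBl -mulrA fd.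
  exists (e + d) => _; split.
  - rewrite dE; apply: submoduleD => //; apply: submoduleB => //.
    exact: left_idealMl.
  - by rewrite mulrDl !mulrDr Ed de dd ee addr0 add0r.
  - by rewrite mulrDr ee Ed addr0.
  - by rewrite mulrDl ee de addr0.
  - by rewrite addrC addKr => Id; apply: nIf; rewrite -fd; exact: left_idealMl.
have [next nextP] := choice step.
pose e_ n := iter n next 0.
have eP n : K (e_ n) /\ e_ n * e_ n = e_ n.
  elim: n => [|n /nextP[]//]; split; [exact: submodule0|exact: mul0r].
have eS n := nextP _ (eP n).
have mono (x : R) m n : (m <= n)%N -> x * e_ m = x -> x * e_ n = x.
  move=> /subnK <- xm; elim: (n - m)%N => // k IH.
  have [_ _ eeS _ _] := eS (k + m)%N.
  by rewrite -{1}IH -mulrA [e_ (k + m)%N * _]eeS.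
(* The union of the left ideals R e_n, which increase because [e_n e_(n+1) = e_n]. *)
pose U : set R^o := [set x | exists n, (x : R) * e_ n = x].
have U0 : U 0 by exists 0; rewrite mul0r.
have UD x y : U x -> U y -> U (x + y).
  move=> [m xm] [n yn]; exists (maxn m n).
  by rewrite mulrDl (mono x m) ?leq_maxl // (mono y n) ?leq_maxr.
have UZ a x : U x -> U (a *: x).
  by move=> [n xn]; exists n; rewrite /GRing.scale /= -mulrA xn.
have [|n [[k /= nk] nP]] := cgen (Submodule U0 UD UZ).
  exists [set e_ n | n in setT]; split.
    exact: card_image_le.
  apply/seteqP; split=> [|x [m xm]].
    by apply: lin_combs_sub => a _ _ [m _ <-]; exists m; rewrite /= -mulrA (eP m).2.
  by rewrite -xm; apply: (@lin_combs1 R R^o setT _ x (e_ m)) => //; exists m.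
(* Since [n] lies in R e_k, the next difference [f] satisfies [n f = 0], so [f = (f - f n) f] lies
   in [I]. *)
have [_ e'e' ee' e'e nI] := eS k; set f := next (e_ k) - e_ k in nI.
have ff : f * f = f by rewrite mulrBl !mulrBr e'e' ee' e'e (eP k).2 subrr subr0.
have nf : n * f = 0 by rewrite -nk -mulrA mulrBr ee' (eP k).2 subrr mulr0.
have If : I (f - f * n).
  apply: nP; exists k.+1; rewrite /= mulrBl ee' -/(e_ k.+1).
  by rewrite [e_ k.+1 * _]e'e'.
apply: nI; have -> : f = (f - f * n) * f by rewrite mulrBl ff -mulrA nf mulr0 subr0.
exact: Defs.idealMr.
Qed.

Lemma cyclic_countably_generated (x : R) :
  countably_generated (cyclic (x : R^o)).
Proof.
exists [set x : R^o]; split; first exact: countable1.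
apply/seteqP; split=> [|_ [a ->]]; last exact: lin_combs1.
by apply: lin_combs_sub => a _ _ ->; exists a.
Qed.

(** For [x] in [L] outside [I], the idempotent [e] splitting Rx is outside [I]: otherwise
    [x = (x - x e) + x e] would lie in [I]. *)
Lemma countably_generated_I_splits :
  (forall K, countably_generated K -> I_splits K) -> forall K, I_splits K.
Proof.
move=> spl; apply: I_splits_of_chain => [L|K /spl[e [Ke _ eI]]]; last by exists e.
move=> /existsNP[x /not_implyP[Lx nIx]].
have [e [xe ee Ie]] := spl _ (cyclic_countably_generated x).
exists e; split=> //; first exact: cyclic_sub xe.
move=> Iee; apply: nIx; rewrite -[x](subrK ((x : R) * e)).
by apply: submoduleD; [exact/Ie/cyclic_id|exact: left_idealMl].
Qed.

(** * Maximal left ideals and semisimplicity modulo [I] *)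

Definition maximal_submodule (m : submodule R^o) :=
  ~ m 1 /\ forall Y : submodule R^o, m `<=` Y -> ~ Y 1 -> Y `<=` m.

Lemma maximal_submodule_exists Q : ~ Q 1 ->
  exists m : submodule R^o, Q `<=` m /\ maximal_submodule m.
Proof.
move=> Q1; have [x [Qx x1]|m [Qm m1 mmax]] :=
    @maximal_disjoint_submodule R R^o Q [set (1 : R)].
  by apply: Q1; rewrite -x1.
exists m; split=> //; split=> [m1'|Y mY Y1]; first by apply: (m1 1).
by apply: mmax => // x [Yx x1]; apply: Y1; rewrite -x1.
Qed.

Lemma maximal_simple_quotient m :
  maximal_submodule m -> simple_module (quot_mod m).
Proof.
move=> [m1 mmax]; split.
  exists (quot_proj m 1); rewrite -(linear0 (quot_proj m)).
  by move=> /quot_proj_eq; rewrite subr0.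
move=> K; pose Y := preimage_submodule (quot_proj m) K.
have mY : m `<=` Y.
  move=> x mx; rewrite /Y /= /preimage /=.
  have -> : quot_proj m x = 0; last exact: submodule0.
  by rewrite -(linear0 (quot_proj m)); apply/quot_proj_eq; rewrite subr0.
have [Y1|nY1] := pselect (Y 1).
  right; apply/seteqP; split=> // q _; rewrite -[q]quot_reprK.
  by rewrite -[quot_repr q]mulr1; exact: (submoduleZ (quot_repr q : R) Y1).
left; apply/seteqP; split=> [q Kq|_ ->]; last exact: submodule0.
rewrite /= -[q]quot_reprK -(linear0 (quot_proj m)); apply/quot_proj_eq.
by rewrite subr0; apply: (mmax Y) => //; rewrite /Y /= /preimage /= quot_reprK.
Qed.

Section MaximalSplits.
Hypothesis max_splits : forall m, maximal_submodule m -> I_splits m.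

(* [R / I] is semisimple because each of its maximal left ideals is a direct
   summand. *)
Lemma complement_mod_ideal N : I `<=` N ->
  exists Q : submodule R^o, [/\ I `<=` Q, forall x : R, submodule_sum Q N x
    & Q `&` N `<=` I].
Proof.
move=> IN; have [|Q [IQ QN Qmax]] := @maximal_disjoint_submodule R R^o I (N `\` I).
  by move=> x [Ix [_ /(_ Ix)]].
have QNI : Q `&` N `<=` I.
  by move=> x [Qx Nx]; apply: contrapT => nIx; apply: (QN x).
exists Q; split=> //.
suff H : join Q N 1 by move=> x; rewrite -[x]mulr1; exact: (submoduleZ x H).
(* Otherwise Q + N lies in a maximal [m], split by some [g]. It is shown that Q + R(1 - g) still
   meets [N] inside [I]; maximality of [Q] puts [1 - g] in [Q], hence 1 in [m]. *)
apply: contrapT => /maximal_submodule_exists[m [QNm mmax]].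
have [g [mg gg mI]] := max_splits mmax.
have Qm : Q `<=` m by move=> x /(join_subl N) /QNm.
have Nm : N `<=` m by move=> x /(join_subr Q) /QNm.
case: (mmax) => m1 _; apply: m1; rewrite -(subrK g 1).
apply: submoduleD => //; apply: (Qm).
apply: (Qmax (join Q (cyclic (1 - g : R^o)))).
- exact: join_subl.
(* If [q + y] is in [N], then [y] is in [m], and [y g = 0] forces [y] into [I]; so [q] is in both
   [Q] and [N], hence in [I]. *)
- move=> _ [[q [_ [Qq [r ->] ->]]] [Nx nIx]]; apply: nIx.
  set y : R := r * (1 - g).
  have my : m y.
    rewrite -(addKr q y) addrC; apply: submoduleB; first exact: Nm.
    exact: (Qm).
  have Iy : I y.
    have := mI _ my; rewrite /y -mulrA mulrBl mul1r gg subrr mulr0 subr0; exact.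
  apply: submoduleD => //; apply: QNI; split=> //.
  by rewrite -[q](addrK (y : R^o)); apply: submoduleB => //; exact: IN.
- exact/join_subr/cyclic_id.
Qed.

(** A complement of I + L modulo [I] lies in a maximal [m] split by [g], so I + (Rg + L) = R. PSD
    then makes X = Rg + L a true summand of R, generated by an idempotent, from which the part
    coming from [L] is extracted. *)
Lemma psd_idempotent L : psd_in I -> ~ (L `<=` I) ->
  exists f : R, [/\ L f, f * f = f & ~ I f].
Proof.
move=> psdI LI.
have [Q [IQ QN QNI]] := complement_mod_ideal (@join_subl R R^o I L).
have [Q1|m [Qm mmax]] := @maximal_submodule_exists Q.
  apply: LI => x Lx; apply: QNI; split; last exact: join_subr.
  by rewrite -[x]mulr1; exact: (submoduleZ (x : R) Q1).
have [g [mg gg mI]] := max_splits mmax.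
have m1 : ~ m 1 by case: mmax.
have [|S [_ SI [SXT SX0]]] := psdI (join (cyclic (g : R^o)) L).
  apply/seteqP; split=> // x _.
  have [q [_ [Qq [i [l [Ii Ll ->]]] ->]]] := QN x.
  exists ((q : R) - (q : R) * g + i : R), ((q : R) * g + l : R); split.
  - by apply: submoduleD => //; exact/mI/Qm.
  - exists ((q : R) * g : R), l; split=> //; by exists q.
  - by rewrite addrACA subrK.
set X := join _ _ in SXT SX0.
have : submodule_sum S X 1 by rewrite SXT.
move=> [s [x [Ss Xx sx]]].
(* With [1 = s + x], right multiplication by [s] kills [X]; so [x] is idempotent and a right
   identity on [X]. *)
have Xs (z : R) : X z -> z * s = 0.
  move=> Xz; suff : (S `&` X) (z * s) by rewrite SX0.
  split; first exact: left_idealMl.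
  have -> : z * s = z - z * x by rewrite -[z in z - _]mulr1 sx mulrDr addrK.
  by apply: submoduleB => //; exact: left_idealMl.
have Xx1 (z : R) : X z -> z * x = z.
  by move=> Xz; rewrite -[RHS]mulr1 sx mulrDr Xs // add0r.
have Xg : X g by exact/join_subl/cyclic_id.
case: (Xx) => [_ [l [[r ->] Ll xE]]].
have Xl : X l by exact: join_subr.
(* The factor [1 - g] removes the Rg-part of [x], leaving [l (1 - g)]. This [y] is idempotent but
   need not lie in [L]; [y l] does, and [l y = y] makes it idempotent. *)
pose y : R := x * (1 - g).
have yl : y = (l : R) * (1 - g).
  by rewrite /y xE mulrDl /GRing.scale /= -mulrA mulrBr mulr1 gg subrr mulr0 add0r.
have ly : (l : R) * y = y by rewrite /y mulrA Xx1 // -yl.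
have yy : y * y = y.
  have xx : x * x = x by exact: Xx1.
  have g0 : g * (1 - g) = 0 by rewrite mulrBr mulr1 gg subrr.
  rewrite /y -mulrA [(1 - g) * (x * _)]mulrA (mulrBl x 1 g) mul1r Xx1 //.
  by rewrite mulrBl g0 subr0 mulrA xx.
exists (y * l); split; first exact: left_idealMl.
  by rewrite -mulrA [(l : R) * (y * l)]mulrA ly mulrA yy.
(* Then [y = y y = (y l) (1 - g)] is in [I], and so is [1 - g = s (1 - g) + y]; thus 1 would lie in
   [m]. *)
move=> Iyl; apply: m1.
have Iy : I y by rewrite -yy {2}yl mulrA; exact: Defs.idealMr.
rewrite -(subrK g 1); apply: submoduleD => //; apply/Qm/IQ.
have -> : 1 - g = s * (1 - g) + y by rewrite /y -mulrDl -sx mul1r.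
by apply: submoduleD => //; apply: Defs.idealMr; exact: SI.
Qed.

Lemma maximal_I_splits : psd_in I -> forall K, I_splits K.
Proof.
move=> psdI; apply: I_splits_of_chain => [L|K _]; first exact: psd_idempotent.
have [Q [IQ QN QNI]] := complement_mod_ideal (@join_subl R R^o I K).
(* The [K]-component [n] of 1 is idempotent only modulo [I], which suffices for
   [I_splits_of_chain]. *)
have [q [_ [Qq [i [n [Ii Kn ->]]] e1]]] := QN 1.
exists n; split=> // x Kx.
have xE : x - x * n = x * (q + i).
  by rewrite -{1}[x]mulr1 e1 addrA mulrDr addrK.
rewrite xE; apply: QNI; split.
  by apply: left_idealMl; apply: submoduleD => //; exact: IQ.
by rewrite -xE; apply: join_subr; apply: submoduleB => //; exact: left_idealMl.
Qed.

End MaximalSplits.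

(** * Covers of finitely generated modules *)

Lemma free_decomposition n (K : submodule 'rV[R]_n) :
  (forall L, I_splits L) ->
  exists A B : submodule 'rV[R]_n,
    [/\ direct_decomposition A B, A `<=` K
      & forall x j, K x -> B x -> I (x 0 j)].
Proof.
move=> spl.
suff H k : (k <= n)%N -> exists A B : submodule 'rV[R]_n,
    [/\ direct_decomposition A B, A `<=` K
      & forall x (j : 'I_n), (j < k)%N -> K x -> B x -> I (x 0 j)].
  have [A [B [dec AK KB]]] := H n (leqnn n).
  by exists A, B; split=> // x j; exact: KB.
elim: k => [_|k IH kn].
  exists (cyclic 0), (full_submodule _); split=> //; last first.
    by apply: cyclic_sub; exact: submodule0.
  apply: direct_decompositionP => [x|x [a ->] _]; last by rewrite scaler0.
  by exists 0, x; split; rewrite ?add0r //; exact: submodule0.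
have [A [B [[ABT AB0] AK KB]]] := IH (ltnW kn).
pose i := Ordinal kn.
have lpi : linear (fun v : 'rV[R]_n => v 0 i : R^o).
  by move=> a u v; rewrite !mxE.
have [p pE] := linear_of_fun lpi.
(* The [i]-th coordinates of the elements of K [&] B form a left ideal; its idempotent [e] is the
   coordinate of some [c0]. *)
have [e [[c0 [Kc0 Bc0] c0e] ee eI]] := spl (image_submodule p (meet K B)).
rewrite pE in c0e.
(* Scaling by [e] keeps the coordinate [e] and gives [e c = c], so [r e = 0] forces [r c = 0]: this
   makes the new sum direct. *)
have [c cE] : exists c, c = e *: c0 by exists (e *: c0).
have Kc : K c by rewrite cE; exact: submoduleZ.
have Bc : B c by rewrite cE; exact: submoduleZ.
have ci : c 0 i = e by rewrite cE mxE c0e ee.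
have ec : e *: c = c by rewrite cE scalerA ee.
(* On the new complement [x_i e = 0], so [x_i = x_i - x_i e] is in [I] when [x] is in [K]. *)
exists (join A (cyclic c)), (meet B (preimage_submodule p (annihilator e))).
split.
- apply: direct_decompositionP => [x|x [a [_ [Aa [r ->] ->]]] [Bx /= xe]].
    have : submodule_sum A B x by rewrite ABT.
    move=> [a [b [Aa Bb ->]]]; exists (a + b 0 i *: c), (b - b 0 i *: c).
    split; last by rewrite addrACA subrr addr0.
      by exists a, (b 0 i *: c); split=> //; exists (b 0 i).
    split; first by apply: submoduleB => //; exact: submoduleZ.
    by rewrite /= /preimage /= pE !mxE ci mulrBl -mulrA ee subrr.
  have a0 : a = 0.
    suff : (A `&` B) a by rewrite AB0.
    split=> //; rewrite -(addrK (r *: c) a).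
    by apply: submoduleB => //; exact: submoduleZ.
  move: xe; rewrite a0 add0r /preimage /= pE mxE ci -mulrA ee => re.
  by rewrite -ec scalerA re scale0r.
- by move=> _ [a [_ [Aa [r ->] ->]]]; apply: submoduleD; [exact: AK|exact: submoduleZ].
- move=> x j; rewrite ltnS leq_eqVlt => /orP[/eqP jk|jk] Kx [Bx /= xe]; last exact: KB.
  have -> : j = i by exact: val_inj.
  move: xe; rewrite /preimage /= pE => xe.
  have := eI (x 0 i); rewrite xe subr0; apply.
  by exists x; rewrite ?pE.
Qed.

Lemma finitely_generated_quotient_free (M : lmodType R) :
  finitely_generated M ->
  exists n (f : {linear 'rV[R]_n -> M}), surjective f.
Proof.
move=> [X [/finite_seqP[s Xs] XM]]; exists (size s).
have lf : linear (fun v : 'rV[R]_(size s) => \sum_i v 0 i *: s`_i).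
  move=> r u v; rewrite scaler_sumr -big_split /=; apply: eq_bigr => i _.
  by rewrite !mxE scalerDl scalerA.
have [f fE] := linear_of_fun lf; exists f => y.
have : Defs.span X y by rewrite XM.
suff /(_ y) H : Defs.span X `<=` image_submodule f (full_submodule _).
  by move=> /H[x _ <-]; exists x.
apply: lin_combs_sub => a m _; rewrite Xs => ms.
apply: submoduleZ; have mi : (index m s < size s)%N by rewrite index_mem.
exists (delta_mx 0 (Ordinal mi)) => //.
rewrite fE (bigD1 (Ordinal mi)) //= big1 => [|j /negPf ji].
  by rewrite mxE !eqxx scale1r nth_index // addr0.
by rewrite mxE ji andbF scale0r.
Qed.

(** PSD passes from R^n to its summand [B]: a submodule [X] of [B] is enlarged to A + X, and the
    summand [S] obtained in R^n lies in [B], where it complements [X]. *)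
Lemma finitely_generated_cover (M : lmodType R) :
  left_psd_ring I -> (forall L, I_splits L) ->
  finitely_generated M -> has_projective_cover I M.
Proof.
move=> psdI spl /finitely_generated_quotient_free[n [f fs]].
have [A [B [AB Af KB]]] := free_decomposition (kernel f) spl.
have [p [pB _ pid]] := projection (direct_decompositionC AB).
have [q qE] := corestrict pB.
have qK (z : sub_mod B) : q (val z) = z.
  apply: val_inj; rewrite qE pid //.
  by have /asboolP := valP z.
have Bproj : projective (sub_mod B).
  apply: summand_projective (direct_decompositionC AB).
  exact: free_projective.
have coordI (x : 'rV[R]_n) : (forall j, I (x 0 j)) -> ideal_mul I 'rV[R]_n x.
  move=> xI; rewrite [x]row_sum_delta.
  by exists n, (fun j => x 0 j), (fun j => delta_mx 0 j).
have [ABT AB0] := AB.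
have valB (z : sub_mod B) : B (val z) by have /asboolP := valP z.
exists (sub_mod B), [the {linear _ -> _} of f \o val]; split=> //.
- move=> y; have [x <-] := fs y; have : submodule_sum A B x by rewrite ABT.
  move=> [a [b [/Af fa Bb ->]]].
  have kb : submodule_pred B b by apply/asboolP.
  by exists (Sub b kb); rewrite /= linearD fa add0r.
(* The retraction [q] of R^n onto [B] carries I R^n into IB. *)
- move=> z fz; rewrite -[z]qK; apply: ideal_mul_map; apply: coordI => j.
  exact: KB.
- move=> X NX; set N := kernel _ in NX *.
  pose v : {linear sub_mod B -> 'rV[R]_n} := [the {linear _ -> _} of val].
  have NI : meet (kernel f) B `<=` ideal_mul I 'rV[R]_n.
    by move=> x [fx Bx]; apply: coordI => j; exact: KB.
  have fgR : fg_free 'rV[R]_n by exists n, [the {linear _ -> _} of idfun]; exists id.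
  have [|S [Sproj SN [SXT SX0]]] := psdI _ fgR _ NI (join A (image_submodule v X)).
    apply/seteqP; split=> // x _; have : submodule_sum A B x by rewrite ABT.
    move=> [a [b [Aa Bb ->]]].
    have kb : submodule_pred B b by apply/asboolP.
    have : submodule_sum N X (Sub b kb) by rewrite NX.
    move=> [z [y [Nz Xy zy]]]; exists (val z), (a + val y); split.
    - by split=> //; exact: Nz.
    - by exists a, (val y); split=> //; exists y.
    - by rewrite addrCA -[val z + val y](raddfD v) -zy.
  have dec : direct_decomposition (preimage_submodule v S) X.
    apply: direct_decompositionP => [z|z Sz Xz].
      have : submodule_sum S (join A (image_submodule v X)) (val z) by rewrite SXT.
      move=> [s [_ [Ss [a [_ [Aa [y Xy <-] ->]]] zE]]].
      have Bs : B s by have [] := SN _ Ss.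
      (* The [A]-component vanishes because [z], [s] and [y] all lie in [B]. *)
      have a0 : a = 0.
        suff : (A `&` B) a by rewrite AB0.
        split=> //; have -> : a = val z - s - v y.
          by rewrite zE [s + _]addrC addrK addrK.
        by apply: submoduleB; [apply: submoduleB|exact: valB].
      have ks : submodule_pred B s by apply/asboolP.
      exists (Sub s ks), y; split=> //.
      by apply: val_inj; rewrite zE a0 add0r raddfD.
    apply: val_inj; rewrite raddf0.
    suff : (S `&` join A (image_submodule v X)) (val z) by rewrite SX0.
    by split=> //; apply: join_subr; exists z.
  exists (preimage_submodule v S); split=> //.
    exact: summand_projective dec.
  by move=> z /SN[].
Qed.

End RegularModule.

(** * Factor modules of R, and the implications *)

Lemma quot_finitely_generated (R : pzRingType) (K : submodule R^o) :
  finitely_generated (quot_mod K).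
Proof.
apply: (@cyclic_finitely_generated _ _ (quot_proj K 1)).
apply/seteqP; split=> // q _; exists (quot_repr q).
rewrite -[LHS]quot_reprK -[RHS]/(quot_scale _ _) quot_scale_proj.
by rewrite /GRing.scale /= mulr1.
Qed.

Theorem theorem2p13 (R : pzRingType) (I : ideal R) :
  let c1 := forall M : lmodType R,
              finitely_generated M -> has_projective_cover I M in
  let c2 := forall K : submodule R^o, has_projective_cover I (quot_mod K) in
  let c3 := forall K : submodule R^o,
              countably_generated K -> has_projective_cover I (quot_mod K) in
  let c4 := semiperfect_ring I in
  let c5 := forall M : lmodType R,
              simple_module M -> has_projective_cover I M in
  let c6 := forall K : submodule R^o,
              simple_module (quot_mod K) ->
              has_projective_cover I (quot_mod K) in
  ((c1 -> c2) /\ (c2 -> c3) /\ (c3 -> c4)) /\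
  ((c1 -> c5) /\ (c5 -> c6)) /\
  (left_psd_ring I -> c4 -> c1) /\
  (psd_in I -> c6 -> c4).
Proof.
move=> c1 c2 c3 c4 c5 c6; split; [split; [|split]|split; [split|split]].
- by move=> h1 K; apply: h1; exact: quot_finitely_generated.
- by move=> h2 K _.
- move=> h3; apply/semiperfect_I_splits/countably_generated_I_splits => K Kc.
  exact/cover_I_splits/h3.
- by move=> h1 M /simple_finitely_generated; exact: h1.
- by move=> h5 K; exact: h5.
- by move=> psdI /semiperfect_I_splits spl M; exact: finitely_generated_cover.
- move=> psdI h6; apply/semiperfect_I_splits/maximal_I_splits => // m mmax.
  by apply/cover_I_splits/h6; exact: maximal_simple_quotient.
Qed.
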